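(* Let $\mathcal{A}$ be Suslin, let $\Phi\colon\mathcal{A}\to\mathbb{R}$ be measurable and semibounded, let $\Psi\colon\mathcal{A}\to\mathbb{R}^n$ be measurable, let $Z\subseteq\mathbb{R}^n$ and $\Pi(Z):=\{\pi\in\mathcal{M}(\mathcal{A}):\mathbb{E}_\pi[\Psi]\in Z\}$. Let $\mathcal{D}$ be a metrizable Suslin space, $\mathbb{D}\colon\mathcal{A}\to\mathcal{M}(\mathcal{D})$ measurable and $B\subseteq\mathcal{D}$ open. Then $\mathcal{U}(\Pi(Z)\,|\,B)$ equals the supremum over $\alpha_0,\dots,\alpha_n\ge0$, $q\in Z$ and $\mu_0,\dots,\mu_n\in\mathcal{A}$ of $\sum_{i=0}^n\alpha_i\Phi(\mu_i)\mathbb{D}(\mu_i)[B]$ subject to the constraints $\sum_{i=0}^n\alpha_i(\Psi(\mu_i)-q)=0$ and $\sum_{i=0}^n\alpha_i\mathbb{D}(\mu_i)[B]=1$.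
   Context: $\mathcal{M}(\mathcal{Y})$: Borel probability measures. Posterior: for $\Pi\subseteq\mathcal{M}(\mathcal{A})$, $\Pi_B:=\{\pi\in\Pi:\mathbb{E}_{\mu\sim\pi}[\mathbb{D}(\mu)[B]]>0\}$, $\mathbb{E}_{\pi\odot\mathbb{D}}[\Phi|B]:=\mathbb{E}_{\mu\sim\pi}[\Phi(\mu)\mathbb{D}(\mu)[B]]/\mathbb{E}_{\mu\sim\pi}[\mathbb{D}(\mu)[B]]$, and $\mathcal{U}(\Pi|B):=\sup_{\pi\in\Pi_B}\mathbb{E}_{\pi\odot\mathbb{D}}[\Phi|B]$; suprema over empty sets are $-\infty$. Implicit in $\mathbb{E}_\pi[\Psi]\in Z$ is that the integral exists. *)

(* Defs.v *)
From HB Require Import structures.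
From mathcomp Require Import all_boot all_order all_algebra.
From mathcomp Require Import all_classical all_reals all_analysis.
From mathcomp Require Import measurable_realfun.

Set Implicit Arguments.
Unset Strict Implicit.
Unset Printing Implicit Defensive.
Import Order.TTheory GRing.Theory Num.Theory.
Local Open Scope classical_set_scope.
Local Open Scope ring_scope.

Definition is_metric (R : realType) (T : Type) (d : T -> T -> R) : Prop :=
  (forall x y, 0 <= d x y) /\ (forall x y, d x y = 0 <-> x = y) /\
  (forall x y, d x y = d y x) /\ (forall x y z, d x z <= d x y + d y z).

Definition induces_topology (R : realType) (T : topologicalType)
  (d : T -> T -> R) : Prop :=
  forall U : set T, open U <->
    (forall x, U x -> exists2 e : R, 0 < e & [set y | d x y < e] `<=` U).

Definition metrizable (R : realType) (T : topologicalType) : Prop :=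
  exists d : T -> T -> R, is_metric d /\ induces_topology d.

Definition polish (R : realType) (T : topologicalType) : Prop :=
  (exists d : T -> T -> R, [/\ is_metric d, induces_topology d &
     forall u : nat -> T,
       (forall e : R, 0 < e -> exists N, forall m n, (N <= m)%N -> (N <= n)%N ->
          d (u m) (u n) < e) ->
       exists x : T, u @ \oo --> x]) /\
  (exists S : set T, countable S /\ dense S).

Definition suslin (R : realType) (T : topologicalType) : Prop :=
  hausdorff_space T /\
  exists (P : topologicalType) (f : P -> T),
    [/\ polish R P, continuous f & forall y : T, exists x : P, f x = y].

Notation Borel T := (g_sigma_algebraType (@open T)).

Definition semibounded (R : realType) (T : Type) (f : T -> R) : Prop :=
  (exists M : R, forall x, f x <= M) \/ (exists M : R, forall x, M <= f x).

Definition mean_in (R : realType) (A : ptopologicalType) (n : nat)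
  (Psi : A -> 'rV[R]_n) (Z : set 'rV[R]_n) (pi : probability (Borel A) R) : Prop :=
  (forall i : 'I_n, pi.-integrable [set: Borel A] (fun a => (Psi a ord0 i)%:E)) /\
  Z (\row_(i < n) Rintegral pi [set: Borel A] (fun a => Psi a ord0 i)).

Definition PiZ (R : realType) (A : ptopologicalType) (n : nat)
  (Psi : A -> 'rV[R]_n) (Z : set 'rV[R]_n) : set (probability (Borel A) R) :=
  [set pi | mean_in Psi Z pi].

Section Posterior.
Context (R : realType) (A Dsp : ptopologicalType).
Context (Phi : A -> R) (DD : A -> probability (Borel Dsp) R) (B : set Dsp).
Local Open Scope ereal_scope.

Definition PiB (Pi : set (probability (Borel A) R)) :
    set (probability (Borel A) R) :=
  [set pi | Pi pi /\ 0 < \int[pi]_(a in [set: Borel A]) DD a B].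

Definition post_exp (pi : probability (Borel A) R) : \bar R :=
  (\int[pi]_(a in [set: Borel A]) ((Phi a)%:E * DD a B)) *
  ((fine (\int[pi]_(a in [set: Borel A]) DD a B))^-1)%:E.

(* U(Pi | B); ereal_sup of the empty set is -oo *)
Definition U_post (Pi : set (probability (Borel A) R)) : \bar R :=
  ereal_sup [set post_exp pi | pi in PiB Pi].
End Posterior.

(* Main.v *)
Require Import Defs.
From HB Require Import structures.
From mathcomp Require Import all_boot all_order all_algebra.
From mathcomp Require Import all_classical all_reals all_analysis.
From mathcomp Require Import measurable_realfun lra ring.
Import Order.TTheory GRing.Theory Num.Theory.
Import HBNNSimple.
Local Open Scope classical_set_scope.
Local Open Scope ring_scope.

(* Write d(a) = D(a)[B] and let pi have mean q in Z and c = E_pi[d] > 0.  The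
   mean of an integrable vector lies in the convex hull of its range, without any
   closure: otherwise a nonzero linear functional is nonnegative on the range of
   the centered vector, hence a.e. zero on it, and the dimension drops.  Applied
   to (Psi, d, g) with g integrable, g <= Phi d and E_pi[g] close to
   E_pi[Phi d], this yields finitely many points satisfying the constraints with
   value E_pi[g] / c.  The n + 1 linear constraints then allow the support to be
   cut down to n + 1 points without decreasing the objective, because a
   nonnegative kernel direction has sum d = 0 and so does not move the
   objective.  Conversely, normalised weights define a mixture of Dirac masses. *)

(** * Separation of the origin from a convex cone *)

(** The image of [K] under the coordinates [L] is a convex cone missing the origin, and no closure
    is available. Induction on the number of coordinates: either the last one has constant sign on
    [K], or a functional found on its zero slice is extended by one coefficient, as in the
    Hahn-Banach extension step. *)
Lemma nonneg_functional (R : realType) (V : Type) (k : nat) (K : set V)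
    (L : 'I_k -> V -> R) :
  (forall u v s t, K u -> K v -> 0 < s -> 0 < t ->
     exists2 w, K w & forall i, L i w = s * L i u + t * L i v) ->
  (forall v, K v -> exists i, L i v != 0) ->
  K !=set0 ->
  exists2 l : 'I_k -> R, (exists i, l i != 0) &
    forall v, K v -> 0 <= \sum_(i < k) l i * L i v.
Proof.
elim: k K L => [|k IH] K L mixK nzK [v0 Kv0]; first by have [[]] := nzK _ Kv0.
have signed e : e != 0 -> (forall v, K v -> 0 <= e * L ord_max v) ->
    exists2 l : 'I_k.+1 -> R, (exists i, l i != 0) &
    forall v, K v -> 0 <= \sum_(i < k.+1) l i * L i v.
  move=> e0 eK; exists (fun i => if i == ord_max then e else 0).
    by exists ord_max; rewrite eqxx.
  move=> v Kv; rewrite (bigD1 ord_max)//= eqxx big1 ?addr0; first exact: eK.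
  by move=> i /negbTE ->; rewrite mul0r.
have [pos|] := pselect (forall v, K v -> 0 <= L ord_max v).
  by apply: (signed 1) => [|v Kv]; rewrite ?oner_neq0// mul1r pos.
move=> /existsNP[vn /not_implyP[Kvn /negP]]; rewrite -ltNge => vn0.
have [neg|] := pselect (forall v, K v -> L ord_max v <= 0).
  by apply: (signed (-1)) => [|v Kv]; rewrite ?oppr_eq0 ?oner_neq0// mulN1r oppr_ge0 neg.
move=> /existsNP[vp /not_implyP[Kvp /negP]]; rewrite -ltNge => vp0.
pose w := @widen_ord k k.+1 (leqnSn k).
have wE i : w i = lift ord_max i.
  by apply/val_inj; rewrite /= /bump leqNgt ltn_ord.
pose H := [set v | K v /\ L ord_max v = 0].
(* Points on opposite sides of the slice combine with weights that cancel the last coordinate. *)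
have mixH u v : K u -> K v -> 0 < L ord_max u -> L ord_max v < 0 ->
    exists2 x, H x & forall i, L i x = - L ord_max v * L i u + L ord_max u * L i v.
  move=> Ku Kv u0 Lv0.
  have [|x Kx xE] := mixK u v (- L ord_max v) (L ord_max u) Ku Kv _ u0.
    by rewrite oppr_gt0.
  by exists x => //; split=> //; rewrite xE; ring.
have [| | |l' [i0 li0] lH] := IH H (fun i => L (w i)).
- move=> u v s t [Ku u0] [Kv Lv0] s0 t0.
  have [x Kx xE] := mixK u v s t Ku Kv s0 t0.
  by exists x => //; split => //; rewrite xE u0 Lv0 !mulr0 addr0.
- move=> v [Kv Lv0]; have [i Li] := nzK v Kv.
  case: (unliftP ord_max i) Li => [j ->|->]; last by rewrite Lv0 eqxx.
  by move=> Lj; exists j; rewrite wE.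
- by have [x Hx _] := mixH vp vn Kvp Kvn vp0 vn0; exists x.
pose M v := \sum_(i < k) l' i * L (w i) v.
(* Each point with positive last coordinate bounds the missing coefficient from below; these bounds
   form [S]. Each point with negative last coordinate bounds it from above. By [mixH] every lower
   bound is at most every upper bound, so [sup S] satisfies them all. *)
pose S := [set - M v / L ord_max v | v in [set v | K v /\ 0 < L ord_max v]].
have Sub v : K v -> L ord_max v < 0 -> ubound S (- M v / L ord_max v).
  move=> Kv Lv0 _ [u [Ku u0] <-].
  have [x Hx xE] := mixH u v Ku Kv u0 Lv0.
  have : 0 <= - L ord_max v * M u + L ord_max u * M v.
    rewrite /M !mulr_sumr -big_split/=.
    rewrite (_ : \sum_(_ < k) _ = \sum_(i < k) l' i * L (w i) x); first exact: lH.
    by apply: eq_bigr => i _; rewrite xE; ring.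
  rewrite ler_pdivrMr// => h.
  rewrite mulrAC ler_ndivlMr//.
  by lra.
have S0 : S !=set0 by exists (- M vp / L ord_max vp), vp.
have supS : has_sup S by split => //; exists (- M vn / L ord_max vn); exact: Sub.
exists (fun i => if unlift ord_max i is Some j then l' j else sup S).
  by exists (lift ord_max i0); rewrite liftK.
move=> v Kv; rewrite big_ord_recr/= unlift_none.
have -> : \sum_(i < k) (if unlift ord_max (w i) is Some j then l' j else sup S) *
    L (w i) v = M v.
  by apply: eq_bigr => i _; rewrite wE liftK.
have [Lv0|Lv0|Lv0] := ltgtP (L ord_max v) 0.
- have := @ge_sup _ _ _ S0 (Sub v Kv Lv0).
  by rewrite ler_ndivlMr//; lra.
- have : - M v / L ord_max v <= sup S by apply: sup_upper_bound => //; exists v.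
  by rewrite ler_pdivrMr//; lra.
- by rewrite Lv0 mulr0 addr0; exact: lH.
Qed.

(** * Positive combinations of points and vanishing means *)

Section positive_combinations.
Context {R : realType} {T : Type}.

(* The list of pairs (w_j, x_j) stands for the formal sum of the w_j x_j. *)
Definition pos_comb (D : set T) : set (seq (R * T)) :=
  [set s | s <> [::] /\ List.Forall (fun p => 0 < p.1 /\ D p.2) s].

Definition comb_sum (f : T -> R) (s : seq (R * T)) : R :=
  \sum_(p <- s) p.1 * f p.2.

Lemma pos_comb_mix D s t u v : pos_comb D u -> pos_comb D v -> 0 < s -> 0 < t ->
  exists2 w, pos_comb D w &
    forall f, comb_sum f w = s * comb_sum f u + t * comb_sum f v.
Proof.
move=> [u0 Du] [_ Dv] s0 t0.
exists ([seq (s * p.1, p.2) | p <- u] ++ [seq (t * p.1, p.2) | p <- v]).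
  split; first by case: u u0 {Du}.
  apply/List.Forall_app; split; apply/List.Forall_map; [move: Du|move: Dv];
    by apply: List.Forall_impl => -[a x] [/= a0 Dx]; rewrite mulr_gt0.
move=> f; rewrite /comb_sum big_cat !big_map/= !mulr_sumr.
by congr (_ + _); apply: eq_bigr => p _; rewrite mulrA.
Qed.

Lemma pos_comb1 (D : set T) x : D x -> pos_comb D [:: (1, x)].
Proof. by move=> Dx; split=> //; repeat constructor => //=; rewrite ltr01. Qed.

Lemma pos_comb_sub (D E : set T) s : D `<=` E -> pos_comb D s -> pos_comb E s.
Proof.
move=> DE [s0 Ds]; split=> //.
by apply: List.Forall_impl Ds => p [p0 /DE].
Qed.

Lemma eq_comb_sum D (f g : T -> R) s : pos_comb D s -> {in D, f =1 g} ->
  comb_sum f s = comb_sum g s.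
Proof.
move=> [_ Ds] fg; rewrite /comb_sum; elim: s Ds => [|p s IH]; first by rewrite !big_nil.
move=> /List.Forall_cons_iff[[_ Dp] Ds]; rewrite !big_cons IH//.
by rewrite fg// inE.
Qed.

Lemma comb_sum_lin k (l : 'I_k -> R) (f : 'I_k -> T -> R) s :
  comb_sum (fun x => \sum_(i < k) l i * f i x) s = \sum_(i < k) l i * comb_sum (f i) s.
Proof.
rewrite /comb_sum; under eq_bigr do rewrite mulr_sumr.
rewrite exchange_big/=; apply: eq_bigr => i _; rewrite mulr_sumr.
by apply: eq_bigr => p _; rewrite mulrCA.
Qed.

End positive_combinations.

Lemma mean_zero_pos_comb (d : measure_display) (T : measurableType d) (R : realType)
    (mu : {measure set T -> \bar R}) (k : nat) (D : set T) (f : 'I_k -> T -> R) :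
  measurable D -> (0 < mu D)%E ->
  (forall i, mu.-integrable D (EFin \o f i)) ->
  (forall i, \int[mu]_(x in D) (f i x)%:E = 0)%E ->
  exists2 s, pos_comb D s & forall i, comb_sum (f i) s = 0.
Proof.
elim: k D f => [|k IH] D f mD D0 fint fmean.
  have [D00|/set0P[x Dx]] := eqVneq D set0; first by rewrite D00 measure0 ltxx in D0.
  by exists [:: (1, x)]; [exact: pos_comb1|case].
apply: contrapT => nocomb.
have [| | |l [i0 li0] l_ge0] :=
    @nonneg_functional R _ _ (pos_comb D) (fun i => comb_sum (f i)).
- move=> u v s t Du Dv s0 t0; have [w Dw wE] := pos_comb_mix _ _ _ _ _ Du Dv s0 t0.
  by exists w.
- move=> s Ds; apply: contrapT => sN; apply: nocomb; exists s => // i.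
  by apply: contrapT => /eqP si; apply: sN; exists i.
- have [D00|/set0P[x Dx]] := eqVneq D set0; first by rewrite D00 measure0 ltxx in D0.
  by exists [:: (1, x)]; exact: pos_comb1.
pose g x := \sum_(i < k.+1) l i * f i x.
have g_ge0 x : D x -> 0 <= g x.
  move=> Dx; have := l_ge0 _ (pos_comb1 _ _ Dx); rewrite -comb_sum_lin.
  by rewrite /comb_sum big_seq1 mul1r.
have gE : EFin \o g = (fun x => \sum_(i < k.+1) (l i)%:E * (f i x)%:E)%E.
  by apply/funext => x /=; rewrite -sumEFin; apply: eq_bigr.
have lfint i : mu.-integrable D (fun x => (l i)%:E * (f i x)%:E)%E .
  exact: (integrableZl mD (l i) (fint i)).
have gint : mu.-integrable D (EFin \o g) by rewrite gE; apply: integrable_sum.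
have mg : measurable_fun D (EFin \o g) by exact: measurable_int gint.
have gmean : (\int[mu]_(x in D) `|(EFin \o g) x| = 0)%E.
  under eq_integral => x /[!inE] Dx do rewrite gee0_abs ?lee_fin ?g_ge0//.
  rewrite gE integral_sum//= big1// => i _.
  by have := integralZl mD (fint i) (l i) => /= ->; rewrite fmean mule0.
pose N := D `&` [set x | (EFin \o g) x != 0%E].
have mN : measurable N by exact: emeasurable_neq.
have N0 : mu N = 0%E.
  have /(ae_eq_integral_abs mu mD mg) [N' [mN' N'0 NN']] := gmean.
  apply/eqP; rewrite -measure_le0 -N'0; apply: le_measure; rewrite ?inE//.
  by move=> x [Dx gx]; apply: NN' => /= /(_ Dx) gx0; move: gx; rewrite /= gx0 eqxx.
have mDN : measurable (D `\` N) by exact: measurableD.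
have [| | |s Ds s0] := IH (D `\` N) (fun j => f (lift i0 j)) mDN.
- suff <- : mu D = mu (D `\` N) by [].
  have ND : N `<=` D by exact: subIsetl.
  have := @measureU _ _ _ mu N (D `\` N) mN mDN; rewrite setDIK setDUK// => ->//.
  by rewrite -[RHS]add0e; congr (_ + _)%E; exact: N0.
- move=> i; apply: (integrableS mD mDN _ (fint (lift i0 i))); exact: subDsetl.
- move=> i; have := negligible_integral mN mD (fint (lift i0 i)) N0.
  by move=> /= <-; exact: fmean.
(* On [D] minus [N] the relation [g = 0] holds pointwise. The other components sum to zero over [s],
   and [l i0] is nonzero, so component [i0] does too. *)
apply: nocomb; exists s; first by apply: pos_comb_sub Ds; exact: subDsetl.
move=> i; case: (unliftP i0 i) => [j|] -> //.
have : comb_sum g s = comb_sum (fun=> 0) s.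
  apply: eq_comb_sum Ds _ => x /[!inE] -[Dx] /not_andP[//|/negP].
  by rewrite negbK => /eqP [].
rewrite {2}/comb_sum big1 ?comb_sum_lin; last by move=> p _; rewrite mulr0.
rewrite (bigD1_ord i0)//= big1 ?addr0; last by move=> j _; rewrite s0 mulr0.
by move/eqP; rewrite mulf_eq0 (negbTE li0) => /eqP.
Qed.

(** * Reduction of the support *)

(* If e b >= 0, then sum b d = 0 forces b to live where d, hence g, vanishes; so a
   multiple of b that strictly improves the objective has a negative entry. *)
Lemma improving_direction (R : realType) (m : nat) (b d g : 'I_m -> R) :
  (forall i, 0 <= d i) -> (forall i, d i = 0 -> g i = 0) ->
  (exists i, b i != 0) -> \sum_(i < m) b i * d i = 0 ->
  exists e : R, 0 <= \sum_(i < m) (e * b i) * g i /\ exists i, e * b i < 0.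
Proof.
move=> d0 dg [i0 bi0] bd.
have zero e : (forall i, 0 <= e * b i) -> \sum_(i < m) e * b i * g i = 0.
  move=> eb; have : \sum_(i < m) e * b i * d i = 0.
    by under eq_bigr do rewrite -mulrA; rewrite -mulr_sumr bd mulr0.
  move/eqP; rewrite psumr_eq0 => [/allP ebd|i _]; last by rewrite mulr_ge0.
  apply: big1 => i _; have := ebd i (mem_index_enum i).
  by rewrite implyTb mulf_eq0 => /orP[/eqP ->|/eqP /dg ->]; rewrite ?mul0r ?mulr0.
have neg e : 0 < \sum_(i < m) e * b i * g i -> exists i, e * b i < 0.
  move=> bg; apply: contrapT => noneg; move: bg; rewrite zero ?ltxx// => i.
  by rewrite leNgt; apply/negP => ebi; apply: noneg; exists i.
pose S := \sum_(i < m) b i * g i.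
have SE e : \sum_(i < m) e * b i * g i = e * S.
  by rewrite mulr_sumr; under eq_bigr do rewrite -mulrA.
have [S0|S0|S0] := ltgtP S 0.
- by exists (-1); rewrite SE; split; [lra|apply: neg; rewrite SE; lra].
- by exists 1; rewrite SE; split; [lra|apply: neg; rewrite SE; lra].
(* The objective is constant along [b], so only a negative entry is required: this factor turns
   entry [i0] into minus a nonzero square. *)
- exists (- b i0); rewrite SE S0 mulr0; split=> //; exists i0.
  by rewrite mulNr oppr_lt0 -expr2 lt0r sqrf_eq0 bi0 sqr_ge0.
Qed.

Lemma kernel_direction (R : fieldType) (m n : nat) (M : 'M[R]_(m, n)) : (n < m)%N ->
  exists2 b : 'rV[R]_m, (exists i, b 0 i != 0) & b *m M = 0.
Proof.
move=> nm; have : kermx M != 0.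
  rewrite -mxrank_eq0 mxrank_ker -lt0n subn_gt0.
  exact: leq_ltn_trans (rank_leq_col M) nm.
move=> /rowV0Pn[b /sub_kermxP bM b0]; exists b => //.
apply: contrapT => bN; move/eqP: b0; apply; apply/rowP => i; rewrite mxE.
by apply: contrapT => /eqP bi; apply: bN; exists i.
Qed.

(** A Carathéodory step. The total weight is not preserved, so there are only [n + 1] linear
    constraints, and [m + 1 > n + 1] points admit a nonzero direction preserving them. Moving along
    it, with the sign that does not lower the objective, eventually makes a weight zero. *)
Lemma drop_point (R : realType) (T : Type) (m n : nat) (Psi : T -> 'rV[R]_n)
    (d g : T -> R) (a : 'I_m.+1 -> R) (x : 'I_m.+1 -> T) :
  (n < m)%N -> (forall t, 0 <= d t) -> (forall t, d t = 0 -> g t = 0) ->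
  (forall i, 0 <= a i) ->
  exists (a' : 'I_m -> R) (x' : 'I_m -> T),
    [/\ (forall i, 0 <= a' i),
        \sum_(i < m) a' i *: Psi (x' i) = \sum_(i < m.+1) a i *: Psi (x i),
        \sum_(i < m) a' i * d (x' i) = \sum_(i < m.+1) a i * d (x i) &
        \sum_(i < m.+1) a i * g (x i) <= \sum_(i < m) a' i * g (x' i)].
Proof.
move=> nm d0 dg a0.
pose M := row_mx (\matrix_(i < m.+1) Psi (x i)) (\col_(i < m.+1) d (x i)).
have [|b bN0 bM] := @kernel_direction _ _ _ M; first by rewrite addn1 ltnS.
move: bM; rewrite mul_mx_row => /eqP; rewrite row_mx_eq0 => /andP[/eqP bP /eqP bd].
have bPsi : \sum_(i < m.+1) b 0 i *: Psi (x i) = 0.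
  by rewrite -[RHS]bP mulmx_sum_row; apply: eq_bigr => i _; rewrite rowK.
have bdx : \sum_(i < m.+1) b 0 i * d (x i) = 0.
  have /matrixP/(_ 0 0) := bd; rewrite !mxE => bd0; rewrite -[RHS]bd0.
  by apply: eq_bigr => i _; rewrite !mxE.
have [e [eg [i1 ei1]]] := @improving_direction _ _ (b 0) (d \o x) (g \o x)
  (fun i => d0 (x i)) (fun i => dg (x i)) bN0 bdx.
pose c i := e * b 0 i.
have cPsi : \sum_(i < m.+1) c i *: Psi (x i) = 0.
  by under eq_bigr do rewrite -scalerA; rewrite -scaler_sumr bPsi scaler0.
have cd : \sum_(i < m.+1) c i * d (x i) = 0.
  by under eq_bigr do rewrite -mulrA; rewrite -mulr_sumr bdx mulr0.
(* Ratio test: [j] is the first weight to reach zero along [c], and [t] the step length at which it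
   does. *)
have [j cj jmin] := @arg_minP _ _ _ i1 (fun i => c i < 0) (fun i => a i / - c i) ei1.
pose t := a j / - c j.
have t0 : 0 <= t by rewrite divr_ge0// oppr_ge0 ltW.
pose a' i := a i + t * c i.
have a'j : a' j = 0 by rewrite /a' /t; field; rewrite lt_eqF.
have a'0 i : 0 <= a' i.
  rewrite /a'; have [ci|ci] := leP 0 (c i); first by rewrite addr_ge0// mulr_ge0.
  by have := jmin i ci; rewrite -/t ler_pdivlMr ?oppr_gt0//; lra.
exists (fun i => a' (lift j i)), (fun i => x (lift j i)).
(* Stated for an arbitrary module so as to serve [Psi] and, through [R^o], the scalar functions [d]
   and [g]. *)
have sumV (V : lmodType R) (h : T -> V) : \sum_(i < m) a' (lift j i) *: h (x (lift j i)) =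
    \sum_(i < m.+1) a i *: h (x i) + t *: \sum_(i < m.+1) c i *: h (x i).
  transitivity (\sum_(i < m.+1) a' i *: h (x i)).
    by rewrite (bigD1_ord j)//= a'j scale0r add0r.
  rewrite scaler_sumr -big_split/=; apply: eq_bigr => i _.
  by rewrite scalerDl scalerA.
split=> //.
- by rewrite sumV cPsi scaler0 addr0.
- by have := sumV R^o d; rewrite /GRing.scale/= cd mulr0 addr0.
- by have := sumV R^o g; rewrite /GRing.scale/= => ->; rewrite lerDl mulr_ge0.
Qed.

Lemma reduce_support (R : realType) (T : Type) (m n : nat) (Psi : T -> 'rV[R]_n)
    (d g : T -> R) (a : 'I_(m + n.+1) -> R) (x : 'I_(m + n.+1) -> T) :
  (forall t, 0 <= d t) -> (forall t, d t = 0 -> g t = 0) ->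
  (forall i, 0 <= a i) ->
  exists (a' : 'I_n.+1 -> R) (x' : 'I_n.+1 -> T),
    [/\ (forall i, 0 <= a' i),
        \sum_i a' i *: Psi (x' i) = \sum_i a i *: Psi (x i),
        \sum_i a' i * d (x' i) = \sum_i a i * d (x i) &
        \sum_i a i * g (x i) <= \sum_i a' i * g (x' i)].
Proof.
move=> d0 dg; elim: m a x => [|m IH] a x a0; first by exists a, x.
have [|a' [x' [a'0 a'P a'd a'g]]] := @drop_point _ _ (m + n.+1) n Psi d g a x _ d0 dg a0.
  by rewrite addnS ltnS leq_addl.
have [a2 [x2 [a20 a2P a2d a2g]]] := IH a' x' a'0.
exists a2, x2; split => //; first by rewrite a2P.
- by rewrite a2d.
- exact: le_trans a'g a2g.
Qed.

Lemma reduce_comb (R : realType) (T : Type) (n : nat) (Psi : T -> 'rV[R]_n)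
    (d g : T -> R) (D : set T) (s : seq (R * T)) :
  (forall t, 0 <= d t) -> (forall t, d t = 0 -> g t = 0) -> pos_comb D s ->
  exists (a : 'I_n.+1 -> R) (x : 'I_n.+1 -> T),
    [/\ (forall i, 0 <= a i),
        \sum_i a i *: Psi (x i) = \sum_(p <- s) p.1 *: Psi p.2,
        \sum_i a i * d (x i) = comb_sum d s &
        comb_sum g s <= \sum_i a i * g (x i)].
Proof.
move=> d0 dg [s0 Ds].
have [t] : inhabited T by case: s s0 {Ds} => // p *; exact: inhabits p.2.
(* The list is padded with [n + 1] zero weights, the default value of [nth], so that the number of
   points has the required form even when the list is short. *)
have sum_s (V : nmodType) (h : R -> T -> V) : (forall t, h 0 t = 0) ->
    \sum_(p <- s) h p.1 p.2 =
    \sum_(i < size s + n.+1) h (nth 0 (map fst s) i) (nth t (map snd s) i).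
  move=> h0; rewrite (big_nth (0, t)) big_mkord big_split_ord/=.
  rewrite [X in _ = _ + X]big1 ?addr0; last first.
    by move=> i _; rewrite nth_default ?size_map ?leq_addr.
  by apply: eq_bigr => i _; rewrite !(nth_map (0, t)).
have [|a [x [a_ge0 aP ad ag]]] := @reduce_support _ _ (size s) n Psi d g
  (fun i => nth 0 (map fst s) i) (fun i => nth t (map snd s) i) d0 dg.
  move=> i; move: (nat_of_ord i); elim: s {s0 sum_s i} Ds => [_ j|p r IH].
    by rewrite nth_nil.
  by move=> /List.Forall_cons_iff[[p0 _] /IH Dr] [|j] //=; exact: ltW.
exists a, x; rewrite /comb_sum; split => //.
- by rewrite aP -(sum_s _ (fun a t => a *: Psi t))// => ?; rewrite scale0r.
- by rewrite ad -(sum_s _ (fun a t => a * d t))// => ?; rewrite mul0r.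
- apply: le_trans ag.
  by rewrite -(sum_s _ (fun a t => a * g t))// => ?; rewrite mul0r.
Qed.

(** * Representation of means by [n + 1] points *)

Lemma centered_mean_zero (d : measure_display) (T : measurableType d) (R : realType)
    (P : probability T R) (f : T -> R) (c : R) :
  P.-integrable [set: T] (EFin \o f) -> (\int[P]_x (f x)%:E = c%:E)%E ->
  P.-integrable [set: T] (EFin \o (fun x => f x - c)) /\
  (\int[P]_x (f x - c)%:E = 0)%E.
Proof.
move=> fint fc.
have cint : P.-integrable [set: T] (EFin \o cst c).
  by exact: finite_measure_integrable_cst.
split; first exact: (integrableB measurableT fint cint).
have := integralB_EFin measurableT fint cint => /= ->.
have -> : (\int[P]_x c%:E = c%:E)%E.
  have := integral_cst P measurableT c%:E => /= ->.
  by rewrite -[RHS]mule1; congr (_ * _)%E; exact: probability_setT.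
by rewrite fc subee.
Qed.

Lemma comb_sumB (R : realType) (T : Type) (f : T -> R) (c : R) (s : seq (R * T)) :
  comb_sum (fun x => f x - c) s = comb_sum f s - c * comb_sum (fun=> 1) s.
Proof.
rewrite /comb_sum mulr_sumr -sumrB; apply: eq_bigr => p _.
by rewrite mulrBr mulr1 [c * _]mulrC.
Qed.

Lemma pos_comb_mass (R : realType) (T : Type) (D : set T) (s : seq (R * T)) :
  pos_comb D s -> 0 < comb_sum (fun=> 1) s.
Proof.
case: s => [[]//|p s [_ /List.Forall_cons_iff[[p0 _] Ds]]].
rewrite /comb_sum big_cons mulr1 ltr_pwDl//.
elim: s Ds => [|r s IH]; first by rewrite big_nil.
move=> /List.Forall_cons_iff[[r0 _] /IH s0].
by rewrite big_cons mulr1 addr_ge0// ltW.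
Qed.

Lemma finite_moment_representation (disp : measure_display) (T : measurableType disp)
    (R : realType) (P : probability T R) (n : nat) (Psi : T -> 'rV[R]_n) (q : 'rV[R]_n)
    (d g : T -> R) (c e : R) :
  (forall i, P.-integrable [set: T] (fun x => (Psi x 0 i)%:E)) ->
  (forall i, \int[P]_x (Psi x 0 i)%:E = (q 0 i)%:E)%E ->
  P.-integrable [set: T] (EFin \o d) -> (\int[P]_x (d x)%:E = c%:E)%E ->
  P.-integrable [set: T] (EFin \o g) -> (\int[P]_x (g x)%:E = e%:E)%E ->
  (forall x, 0 <= d x) -> (forall x, d x = 0 -> g x = 0) -> 0 < c ->
  exists (a : 'I_n.+1 -> R) (x : 'I_n.+1 -> T),
    [/\ (forall i, 0 <= a i), \sum_i a i *: (Psi (x i) - q) = 0,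
        \sum_i a i * d (x i) = 1 & e / c <= \sum_i a i * g (x i)].
Proof.
move=> Pint Pq dint dc gint ge d0 dg c0.
(* The nested option type gathers the [n + 2] centered functions into one finite family. *)
pose f (j : option (option 'I_n)) (x : T) : R :=
  match j with
  | Some (Some i) => Psi x 0 i - q 0 i
  | Some None => d x - c
  | None => g x - e
  end.
have fP j : P.-integrable [set: T] (EFin \o f j) /\ (\int[P]_x (f j x)%:E = 0)%E.
  by case: j => [[i|]|]; apply: centered_mean_zero => //; exact: Pint.
have [| | |s Ps fs] := @mean_zero_pos_comb _ _ _ P _ setT
    (fun j : 'I_#|{: option (option 'I_n)}| => f (enum_val j)) measurableT.
- by rewrite [ltRHS](@probability_setT _ _ _ P).
- by move=> i; have [] := fP (enum_val i).
- by move=> i; have [] := fP (enum_val i).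
have {}fs j : comb_sum (f j) s = 0 by rewrite -(enum_rankK j).
(* Centering [Psi] at [q] makes its constraint homogeneous, so it survives a change of total
   weight. *)
have [a [x [a0 aP ad ag]]] := @reduce_comb _ _ _ (fun x => Psi x - q) d g _ _ d0 dg Ps.
set W := comb_sum (fun=> 1) s.
have W0 : 0 < W by exact: pos_comb_mass Ps.
have ds : comb_sum d s = c * W.
  by have := fs (Some None); rewrite comb_sumB => /eqP; rewrite subr_eq0 => /eqP.
have gs : comb_sum g s = e * W.
  by have := fs None; rewrite comb_sumB => /eqP; rewrite subr_eq0 => /eqP.
have Ps0 : \sum_(p <- s) p.1 *: (Psi p.2 - q) = 0.
  apply/rowP => i; rewrite summxE mxE -[RHS](fs (Some (Some i))).
  by apply: eq_bigr => p _; rewrite !mxE.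
have cW : 0 < c * W by rewrite mulr_gt0.
(* The weights [a] give [d] the sum [c * W] and [g] at least [e * W]; dividing by [c * W] yields 1
   and at least [e / c]. *)
exists (fun i => (c * W)^-1 * a i), x; split.
- by move=> i; rewrite mulr_ge0// invr_ge0 ltW.
- by under eq_bigr do rewrite -scalerA; rewrite -scaler_sumr aP Ps0 scaler0.
- by under eq_bigr do rewrite -mulrA; rewrite -mulr_sumr ad ds mulVf// gt_eqF.
- under eq_bigr do rewrite -mulrA.
  rewrite -mulr_sumr ler_pdivlMl// (le_trans _ ag)// gs.
  by rewrite le_eqVlt; apply/orP; left; apply/eqP; field; rewrite gt_eqF.
Qed.

(** * Approximation from below by integrable functions *)

(** The integral of [f] may be [+oo], so [f] itself cannot be centered. Replacing its positive part
    by a simple function [h] below it, with nearly the same integral, and keeping the negative part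
    gives [g]. Where [f] is zero, [h] is squeezed to zero. *)
Lemma integrable_minorant (disp : measure_display) (T : measurableType disp)
    (R : realType) (P : probability T R) (f : T -> R) (K : R) :
  measurable_fun [set: T] f ->
  (\int[P]_x (EFin \o f)^\- x < +oo)%E -> (K%:E < \int[P]_x (f x)%:E)%E ->
  exists g : T -> R, [/\ P.-integrable [set: T] (EFin \o g),
    (forall x, g x <= f x), (forall x, f x = 0 -> g x = 0) &
    (K%:E < \int[P]_x (g x)%:E)%E].
Proof.
move=> mf fneg Kf.
have mfE : measurable_fun [set: T] (EFin \o f) by exact/measurable_EFinP.
pose fn (x : T) : R := Num.max (- f x) 0.
have fnE : ((EFin \o f)^\- = EFin \o fn)%E.
  by apply/funext => x; rewrite funenegE /= /fn EFin_max.
have fnint : P.-integrable [set: T] (EFin \o fn).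
  apply/integrableP; split; first by rewrite -fnE; exact: measurable_funeneg.
  under eq_integral => x _ do rewrite -fnE gee0_abs//.
  exact: fneg.
have fnfin : (\int[P]_x (EFin \o f)^\- x)%E \is a fin_num.
  by rewrite fnE; exact: integrable_fin_num.
move: Kf; rewrite integralE lteBrDr// [ltRHS]ge0_integralTE// => Kf.
have [_ [h /= hf <-] Kh] := ereal_sup_gt Kf.
have hint : P.-integrable [set: T] (EFin \o h).
  apply: measurable_bounded_integrable => //.
    by rewrite [ltLHS](@probability_setT _ _ _ P) ltry.
  exact: simple_bounded.
exists (fun x => h x - fn x); split.
- exact: (integrableB measurableT hint fnint).
- move=> x; have := hf x; rewrite funeposE /= -EFin_max lee_fin /fn => hx.
  by rewrite lerBlDr (le_trans hx)// /Num.max; do 2 case: ifPn; lra.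
- move=> x fx0; have := hf x; have h0 : 0 <= h x by exact: fun_ge0.
  rewrite funeposE /= -EFin_max lee_fin /fn fx0 oppr0 maxxx => h1.
  by rewrite subr0; apply/eqP; rewrite eq_le h0 h1.
- have := integralB_EFin measurableT hint fnint => /= ->.
  by rewrite integralT_nnsfun lteBrDr; rewrite fnE in Kh fnfin.
Qed.

(** * Finite mixtures of Dirac masses *)

Lemma dirac_mixture (disp : measure_display) (T : measurableType disp) (R : realType)
    (n : nat) (w : 'I_n.+1 -> R) (x : 'I_n.+1 -> T) :
  (forall i, 0 <= w i) -> \sum_i w i = 1 ->
  exists P : probability T R, forall f : T -> R, measurable_fun [set: T] f ->
    P.-integrable [set: T] (EFin \o f) /\
    (\int[P]_t (f t)%:E = (\sum_i w i * f (x i))%:E)%E.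
Proof.
move=> w0 w1.
pose m_ (k : nat) : {measure set T -> \bar R} :=
  mscale (NngNum (w0 (inord k))) (dirac (x (inord k))).
pose m : {measure set T -> \bar R} := msum m_ n.+1.
have m1 : m setT = 1%E.
  rewrite /m/= /msum/=.
  under eq_bigr do rewrite /mscale/= diracT mule1 inord_val.
  by rewrite sumEFin w1.
(* Normalisation only supplies the probability structure: [m] already has mass 1, and the Dirac mass
   given as argument is the default for mass zero or infinity. *)
pose P : probability T R := mnormalize m (dirac (x ord0)).
have PE f : (\int[P]_t f t = \int[m]_t f t)%E.
  apply: eq_measure_integral => A mA _.
  by rewrite /= /mnormalize/= [msum m_ n.+1 setT]m1 onee_eq0/= invr1 mule1.
have ge0_intP (f : T -> R) : measurable_fun [set: T] f -> (forall t, 0 <= f t) ->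
    (\int[P]_t (f t)%:E = (\sum_i w i * f (x i))%:E)%E.
  move=> mf f0; have mfE : measurable_fun [set: T] (EFin \o f) by exact/measurable_EFinP.
  have f0E t : setT t -> (0 <= (EFin \o f) t)%E by rewrite lee_fin.
  rewrite PE.
  have := @ge0_integral_measure_sum _ _ _ m_ _ measurableT _ f0E mfE n.+1 => /= ->.
  rewrite -sumEFin; apply: eq_bigr => i _.
  have := ge0_integral_mscale (dirac (x (inord i))) measurableT
    (NngNum (w0 (inord i))) mfE f0E => /= ->.
  have := integral_dirac (x (inord i)) measurableT mfE => /= ->.
  by rewrite diracT mul1e inord_val.
exists P => f mf.
have fint : P.-integrable [set: T] (EFin \o f).
  apply/integrableP; split; first exact/measurable_EFinP.
  rewrite (_ : (fun _ => _) = EFin \o (fun t => `|f t|)) ?ge0_intP ?ltry//.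
  exact: measurableT_comp.
split=> //; rewrite integralE.
have mfp : measurable_fun [set: T] (fun t => Num.max (f t) 0).
  by apply: measurable_maxr.
have mfn : measurable_fun [set: T] (fun t => Num.max (- f t) 0).
  by apply: measurable_maxr => //; exact: measurableT_comp.
under eq_integral => t _ do rewrite funeposE /= -EFin_max.
under [X in (_ - X)%E]eq_integral => t _ do rewrite funenegE /= -EFin_max.
rewrite !ge0_intP//; try by move=> t; rewrite le_max lexx orbT.
rewrite -EFinB -sumrB; congr EFin; apply: eq_bigr => i _.
by rewrite -mulrBr /Num.max; congr (_ * _); do 2 case: ifPn; lra.
Qed.

(** * Extended-real comparison and semibounded integrands *)

Lemma lee_EFin_approx (R : realType) (x y : \bar R) :
  (forall K : R, K%:E < x -> K%:E <= y)%E -> (x <= y)%E.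
Proof.
case: x => [r|/= xy|_]; last exact: leNye.
- move=> xy; apply/lee_subgt0Pr => e e0; rewrite -EFinB; apply: xy.
  by rewrite lte_fin ltrBlDr ltrDl.
- case: y xy => [s|//|] xy; last by have := xy 0 (ltry 0); rewrite leeNy_eq.
  by have := xy (s + 1) (ltry _); rewrite lee_fin gerDl ler10.
Qed.

Lemma bounded_integral_lty (disp : measure_display) (T : measurableType disp)
    (R : realType) (P : probability T R) (f : T -> \bar R) (M : R) :
  measurable_fun [set: T] f -> (forall x, 0 <= f x)%E -> (forall x, f x <= M%:E)%E ->
  (\int[P]_x f x < +oo)%E.
Proof.
move=> mf f0 fM; apply: (@le_lt_trans _ _ (\int[P]_x (cst M%:E) x)%E).
  exact: ge0_le_integral.
by rewrite integral_cst// [X in (_ * X)%E](@probability_setT _ _ _ P) mule1 ltry.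
Qed.

(** Semiboundedness rules out [+oo - oo]: a lower bound makes the negative part integrable, while an
    upper bound makes the positive part integrable, so that an infinite negative part forces the
    value [-oo]. *)
Lemma semibounded_integral (disp : measure_display) (T : measurableType disp)
    (R : realType) (P : probability T R) (f : T -> R) :
  measurable_fun [set: T] f -> semibounded f ->
  (\int[P]_x (f x)%:E = -oo)%E \/ (\int[P]_x (EFin \o f)^\- x < +oo)%E.
Proof.
move=> mf sf.
have mfE : measurable_fun [set: T] (EFin \o f) by exact/measurable_EFinP.
have [|neg] := boolP (\int[P]_x (EFin \o f)^\- x < +oo)%E; [by right|left].
have {}neg : (\int[P]_x (EFin \o f)^\- x = +oo)%E.
  by apply/eqP; move: neg; rewrite -leNgt leye_eq.
case: sf => -[M fM].
- rewrite integralE [X in (_ - X)%E]neg.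
  have : (\int[P]_x (EFin \o f)^\+ x < +oo)%E.
    apply: (@bounded_integral_lty _ _ _ _ _ `|M|).
    + exact: measurable_funepos.
    + by move=> x; exact: funepos_ge0.
    + move=> x; rewrite funeposE /= -EFin_max lee_fin ge_max normr_ge0 andbT.
      exact: le_trans (fM x) (ler_norm M).
  rewrite lt_neqAle => /andP[pos _].
  by rewrite addeC/= addNye.
- have : (\int[P]_x (EFin \o f)^\- x < +oo)%E.
    apply: (@bounded_integral_lty _ _ _ _ _ `|M|).
    + exact: measurable_funeneg.
    + by move=> x; exact: funeneg_ge0.
    + move=> x; rewrite funenegE /= -EFin_max lee_fin ge_max normr_ge0 andbT.
      by rewrite lerNl (le_trans _ (fM x))// lerNl -normrN ler_norm.
  by rewrite neg ltxx.
Qed.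

Lemma semiboundedM (R : realType) (T : Type) (f d : T -> R) :
  semibounded f -> (forall x, 0 <= d x <= 1) -> semibounded (fun x => f x * d x).
Proof.
(* The absolute value is taken because multiplying by a factor in [0, 1] may break a negative upper
   bound or a positive lower bound. *)
move=> [] [M fM] d01; [left; exists (Num.norm M)|right; exists (- Num.norm M)] => x;
  have /andP[d0 d1] := d01 x.
- apply: (@le_trans _ _ (`|M| * d x)); last by rewrite ler_piMr.
  by rewrite ler_wpM2r// (le_trans (fM x))// ler_norm.
- apply: (@le_trans _ _ (- `|M| * d x)); first by rewrite mulNr lerN2 ler_piMr.
  by rewrite ler_wpM2r// (le_trans _ (fM x))// lerNl -normrN ler_norm.
Qed.

(** * Equality of the two suprema *)

Theorem theorem4p8 (R : realType) (A : ptopologicalType) (n : nat)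
  (Phi : A -> R) (Psi : A -> 'rV[R]_n) (Z : set 'rV[R]_n)
  (Dsp : ptopologicalType) (DD : A -> probability (Borel Dsp) R) (B : set Dsp) :
  suslin R A ->
  measurable_fun [set: Borel A] Phi -> semibounded Phi ->
  (forall i : 'I_n, measurable_fun [set: Borel A] (fun a => Psi a ord0 i)) ->
  metrizable R Dsp -> suslin R Dsp ->
  (forall E : set (Borel Dsp), measurable E ->
     measurable_fun [set: Borel A] (fun a => DD a E)) ->
  open B ->
  U_post Phi DD B (PiZ Psi Z) =
  ereal_sup [set x : \bar R | exists (alpha : 'I_n.+1 -> R) (q : 'rV[R]_n)
      (mu : 'I_n.+1 -> A),
    [/\ (forall i, 0 <= alpha i), Z q,
        \sum_(i < n.+1) alpha i *: (Psi (mu i) - q) = 0,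
        (\sum_(i < n.+1) (alpha i)%:E * DD (mu i) B = 1)%E &
        x = (\sum_(i < n.+1) (alpha i)%:E * (Phi (mu i))%:E * DD (mu i) B)%E]].
Proof.
move=> _ mPhi sPhi mPsi _ _ mDD oB.
have mB : measurable (B : set (Borel Dsp)) by exact: sub_sigma_algebra.
pose d (a : Borel A) : R := fine (DD a B).
have dE a : DD a B = (d a)%:E by rewrite fineK// fin_num_measure.
have d01 a : 0 <= d a <= 1.
  by rewrite -!lee_fin -dE measure_ge0 probability_le1.
have md : measurable_fun [set: Borel A] d.
  apply/measurable_EFinP.
  have -> : EFin \o d = (fun a => DD a B) by apply/funext => a; rewrite dE.
  exact: mDD.
pose f (a : Borel A) : R := Phi a * d a.
have mf : measurable_fun [set: Borel A] f by exact: measurable_funM.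
have sf : semibounded f by exact: semiboundedM.
have f0 a : d a = 0 -> f a = 0 by rewrite /f => ->; rewrite mulr0.
have postE (P : probability (Borel A) R) : post_exp Phi DD B P =
    ((\int[P]_a (f a)%:E) * (fine (\int[P]_a (d a)%:E))^-1%:E)%E.
  rewrite /post_exp; congr (_ * (fine _)^-1%:E)%E; last exact: eq_integral.
  by apply: eq_integral => a _; rewrite dE.
set S := ereal_sup _; rewrite /U_post.
have inS (a : 'I_n.+1 -> R) q (x : 'I_n.+1 -> A) : (forall i, 0 <= a i) -> Z q ->
    \sum_i a i *: (Psi (x i) - q) = 0 -> \sum_i a i * d (x i) = 1 ->
    ((\sum_i a i * f (x i))%:E <= S)%E.
  move=> a0 Zq aPsi ad; apply: ereal_sup_ubound; exists a, q, x; split => //.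
    by under eq_bigr do rewrite dE -EFinM; rewrite sumEFin ad.
  by under [RHS]eq_bigr do rewrite dE -!EFinM -mulrA; rewrite sumEFin.
apply/eqP; rewrite eq_le; apply/andP; split.
  apply: ge_ereal_sup => _ [P [[Pint Zq] c0] <-]; rewrite postE.
  have dint : P.-integrable [set: Borel A] (EFin \o d).
    apply/integrableP; split; first exact/measurable_EFinP.
    apply: (@bounded_integral_lty _ _ _ _ _ 1).
    - by apply: measurableT_comp => //; exact/measurable_EFinP.
    - by [].
    - by move=> a; rewrite /= lee_fin; have /andP[? ?] := d01 a; rewrite ger0_norm.
  set c := fine _.
  have cE : (\int[P]_a (d a)%:E = c%:E)%E.
    by rewrite fineK//; exact: integrable_fin_num dint.
  have {}c0 : 0 < c.
    move: c0; rewrite -lte_fin -cE; under eq_integral do rewrite dE.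
    by [].
  have [->|fneg] := @semibounded_integral _ _ _ P f mf sf.
    by rewrite gt0_mulNye ?leNye// lte_fin invr_gt0.
  (* The posterior value may be [+oo], so every real [K] strictly below it is compared with [S]. *)
  apply: lee_EFin_approx => K; rewrite lte_pdivlMr// -EFinM => Kf.
  have [g [gint gf g0 Kg]] := @integrable_minorant _ _ _ P f _ mf fneg Kf.
  set q := (\row_(i < n) _) in Zq.
  have eE : (\int[P]_a (g a)%:E = (fine (\int[P]_a (g a)%:E))%:E)%E.
    by rewrite fineK//; exact: integrable_fin_num gint.
  have [i||x|a [x [a0 aPsi ad ag]]] :=
    @finite_moment_representation _ (Borel A) R P n Psi q d g c _
      Pint _ dint cE gint eE _ _ c0.
  - by rewrite /q mxE fineK//; exact: integrable_fin_num (Pint i).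
  - by move=> a; have /andP[] := d01 a.
  - by move=> /f0 /g0.
  apply: le_trans (inS a q x a0 Zq aPsi ad); rewrite lee_fin.
  rewrite (@le_trans _ _ (\sum_i a i * g (x i)))//; last first.
    by apply: ler_sum => i _; rewrite ler_wpM2l.
  apply: le_trans ag; rewrite ler_pdivlMr// ltW// -lte_fin -eE.
  exact: Kg.
apply: ge_ereal_sup => _ [a [q [x [a0 Zq aPsi ad ->]]]].
have {}ad : \sum_i a i * d (x i) = 1.
  by move: ad; under eq_bigr do rewrite dE -EFinM; rewrite sumEFin => -[].
set s := \sum_i a i.
(* As [d] is at most 1, the total weight is at least the sum of the [a i * d (x i)], which is 1. *)
have s0 : 0 < s.
  apply: (@lt_le_trans _ _ 1) => //; rewrite -[leLHS]ad; apply: ler_sum => i _.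
  by have /andP[? ?] := d01 (x i); rewrite ler_piMr.
(* Under the weights [a i / s] the mean of [d] is [1 / s]: it is positive, and dividing by it
   cancels [s] in the posterior value. *)
have [||P PE] := @dirac_mixture _ (Borel A) R n (fun i => a i / s) x.
- by move=> i; rewrite divr_ge0// ltW.
- by rewrite -mulr_suml divff// gt_eqF.
have sumE (h : A -> R) : \sum_i a i / s * h (x i) = (\sum_i a i * h (x i)) / s.
  by rewrite mulr_suml; apply: eq_bigr => i _; rewrite mulrAC.
have [_ dP] := PE d md; rewrite sumE ad div1r in dP.
have [_ fP] := PE f mf; rewrite sumE in fP.
apply: ereal_sup_ubound; exists P; last first.
  rewrite postE dP fP /= invrK -EFinM divfK ?gt_eqF//.
  by under [RHS]eq_bigr do rewrite dE -!EFinM -mulrA; rewrite sumEFin.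
split; last first.
  under eq_integral do rewrite dE.
  by rewrite dP lte_fin invr_gt0.
split=> [i|]; first by have [] := PE _ (mPsi i).
rewrite (_ : \row_i _ = q)//; apply/rowP => i; rewrite mxE /Rintegral.
have [_ ->] := PE _ (mPsi i); rewrite /= (sumE (fun t => Psi t ord0 i)).
(* Read by coordinates, the constraint says that the [a]-weighted sum of [Psi] is [s] times [q], so
   the mixture has mean [q]. *)
have : \sum_j a j * (Psi (x j) ord0 i - q ord0 i) = 0.
  have /rowP/(_ i) := aPsi; rewrite summxE mxE => aPsi0; rewrite -[RHS]aPsi0.
  by apply: eq_bigr => j _; rewrite !mxE.
under eq_bigr do rewrite mulrBr.
rewrite sumrB -mulr_suml => /eqP; rewrite subr_eq0 => /eqP ->.
by rewrite mulrC mulKf// gt_eqF.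
Qed.
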